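(* There is an absolute constant $c>0$ such that the following holds. Let $G$ be any graph that contains an induced minor $H$ with treewidth $w$ and maximum degree $d\ge 1$. Then every MWIS-circuit of $G$ has at least $2^{c\,w/(d\,4^d)}$ gates.
   Context: A graph $H$ is an induced minor of $G$ if $H$ can be obtained from $G$ by vertex deletions and edge contractions. A tropical circuit over a set of variables $X$ is a finite directed acyclic graph whose vertices (gates) have in-degree $0$ or $2$; each in-degree-$0$ gate is labeled by a variable of $X$ or by the constant $0$, each in-degree-$2$ gate is labeled by $\max$ or $+$, and one gate is the output gate. It computes a tropical polynomial over $(\mathbb{R}\cup\{-\infty\},\max,+)$ ($\max$ as addition, $+$ as multiplication): each gate computes a set of monomials (multisets of variables): a leaf $x$ gives $\{x\}$, a leaf $0$ gives the empty monomial, a $\max$ gate the union of its children's sets, a $+$ gate all products of one monomial from each child. For a graph $G$, an MWIS-polynomial of $G$ is a tropical polynomial $f$ in variables $V(G)$ such that (1) every monomial of $f$ is $v_1\cdots v_l$ with $\{v_1,\dots,v_l\}$ an independent set of $G$, and (2) for every independent set $\{v_1,\dots,v_l\}$ of $G$ (including the empty one) the monomial $v_1\cdots v_l$ occurs in $f$. An MWIS-circuit of $G$ is a tropical circuit over $V(G)$ computing an MWIS-polynomial of $G$. *)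

(* Defs.v *)
From mathcomp Require Import all_boot.
From mathcomp Require Import finmap multiset.

Set Implicit Arguments.
Unset Strict Implicit.
Unset Printing Implicit Defensive.

Local Open Scope nat_scope.

Record sgraph := SGraph {
  vertex :> finType;
  edge : rel vertex;
  edge_sym : symmetric edge;
  edge_irr : irreflexive edge }.

Arguments edge {s}.

Definition giso (G H : sgraph) : Prop :=
  exists f : G -> H, bijective f /\ forall x y, edge (f x) (f y) = edge x y.

Section Operations.
Variable G : sgraph.
Implicit Types u v : G.

Definition delv_edge v : rel {x : G | x != v} :=
  [rel x y | edge (val x) (val y)].

Lemma delv_sym v : symmetric (@delv_edge v).
Proof. by move=> x y; rewrite /delv_edge /= edge_sym. Qed.

Lemma delv_irr v : irreflexive (@delv_edge v).
Proof. by move=> x; rewrite /delv_edge /= edge_irr. Qed.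

Definition delv v : sgraph := SGraph (@delv_sym v) (@delv_irr v).

(* [contract u v] merges v into u: the merged vertex is represented by u.
   Loops and parallel edges are suppressed. *)
Definition contract_edge u v : rel {x : G | x != v} :=
  [rel x y | (x != y) &&
     [|| edge (val x) (val y),
         (val x == u) && edge v (val y) |
         (val y == u) && edge v (val x)]].

Lemma contract_sym u v : symmetric (@contract_edge u v).
Proof.
by move=> x y; rewrite /contract_edge /= eq_sym edge_sym; congr (_ && (_ || _));
  rewrite orbC.
Qed.

Lemma contract_irr u v : irreflexive (@contract_edge u v).
Proof. by move=> x; rewrite /contract_edge /= eqxx. Qed.

Definition contract u v : sgraph :=
  SGraph (@contract_sym u v) (@contract_irr u v).

End Operations.

(* [induced_minor H G]: H is, up to isomorphism, obtained from G by a finite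
   sequence of vertex deletions and edge contractions. *)
Inductive induced_minor (H : sgraph) : sgraph -> Prop :=
| IMiso (G : sgraph) of giso H G : induced_minor H G
| IMdel (G : sgraph) (v : G) of induced_minor H (delv v) : induced_minor H G
| IMcontract (G : sgraph) (u v : G) of edge u v & induced_minor H (contract u v) :
    induced_minor H G.

Definition max_degree (G : sgraph) : nat :=
  \max_(v : G) #|[set u : G | edge v u]|.

Definition independent (G : sgraph) (I : {set G}) : Prop :=
  {in I &, forall x y, ~~ edge x y}.

Definition is_tree (T : sgraph) : Prop :=
  [/\ 0 < #|T|,
      (forall x y : T, connect edge x y)
    & (forall c : seq T, ucycle edge c -> size c <= 2)].

Definition tree_decomposition (G T : sgraph) (B : T -> {set G}) : Prop :=
  [/\ is_tree T,
      (forall v : G, exists t, v \in B t),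
      (forall u v : G, edge u v -> exists t, (u \in B t) && (v \in B t))
    & (forall (v : G) (s t : T), v \in B s -> v \in B t ->
         connect [rel x y | [&& edge x y, v \in B x & v \in B y]] s t)].

Definition width (G T : sgraph) (B : T -> {set G}) : nat :=
  (\max_(t : T) #|B t|).-1.

(* As [width] is a natural number, this gives the graph without vertices
   treewidth 0 rather than -1. *)
Definition is_treewidth (G : sgraph) (w : nat) : Prop :=
  (exists (T : sgraph) (B : T -> {set G}),
     tree_decomposition B /\ width B = w) /\
  (forall (T : sgraph) (B : T -> {set G}),
     tree_decomposition B -> w <= width B).

(* The label of an in-degree-2 gate carries the two gates feeding it. *)
Inductive gate_label (X gate : Type) :=
| LVar of X
| LZero
| LMax of gate & gate
| LPlus of gate & gate.

Arguments LZero {X gate}.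
Arguments LVar {X gate}.
Arguments LMax {X gate}.
Arguments LPlus {X gate}.

Definition feeds (X : Type) (gate : eqType) (l : gate -> gate_label X gate) :
    rel gate :=
  [rel h g | match l g with
             | LMax a b | LPlus a b => (h == a) || (h == b)
             | _ => false
             end].

Record tropical_circuit (X : Type) := TropicalCircuit {
  gate : finType;
  label : gate -> gate_label X gate;
  output : gate;
  circuit_acyclic : forall c : seq gate, cycle (feeds label) c -> c = [::] }.

Arguments label {X t}.

Section Semantics.
Local Open Scope mset_scope.
Variables (X : choiceType) (C : tropical_circuit X).

(* [monomial_at g m]: the monomial m belongs to the set computed at gate g. *)
Inductive monomial_at : gate C -> {mset X} -> Prop :=
| MonVar g x of label g = LVar x : monomial_at g [mset x]
| MonZero g of label g = LZero : monomial_at g mset0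
| MonMaxl g a b m of label g = LMax a b & monomial_at a m : monomial_at g m
| MonMaxr g a b m of label g = LMax a b & monomial_at b m : monomial_at g m
| MonPlus g a b m n of label g = LPlus a b & monomial_at a m & monomial_at b n :
    monomial_at g (m `+` n).

Definition computed : {mset X} -> Prop := monomial_at (output C).

End Semantics.

(* Tropical polynomials are identified with their sets of monomials; an
   independent set corresponds to the product of its distinct vertices, each
   with exponent 1. *)
Definition set_monomial (G : sgraph) (I : {set G}) : {mset G}%mset :=
  seq_mset (enum I).

Definition MWIS_polynomial (G : sgraph) (f : {mset G}%mset -> Prop) : Prop :=
  (forall m, f m -> exists2 I : {set G}, independent I & m = set_monomial I) /\
  (forall I : {set G}, independent I -> f (set_monomial I)).

Definition MWIS_circuit (G : sgraph) (C : tropical_circuit G) : Prop :=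
  MWIS_polynomial (computed C).

(* Main.v *)
Require Import Defs.
From mathcomp Require Import all_boot all_order all_algebra zify.
From mathcomp Require Import finmap multiset boolp.
From mathcomp Require Import reals exp.

(** If a monomial [m] computed at a gate is extended to [m n] at the output, then
    no variable of [m] equals or is adjacent to a variable of [n]. So each gate [g]
    carries two anticomplete vertex sets [U g] and [W g], and descending along a
    parse tree shows that every independent set [I], with any marked subset of it,
    lies in some [U g :|: W g] with a third of the marks on either side. In a model
    of [H] in [G], the branch sets not contained in [U g :|: W g] form a separator
    of [H]; marking representatives near a well-linked set of size [w / 2] forces
    this separator to have size at least [w / poly d].

    Branch sets may be taken to be unions of at most [d] shortest paths, hence are
    covered by [2 d + 1] independent sets. Picking an independent set of vertices
    of [H] by local coin flips, and in each chosen branch set one of these sets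
    uniformly, gives a random independent set of [G] which meets every given branch
    set in a given vertex with probability at least [1 / ((2 d + 1) 2 ^ (d + 1))],
    independently at distance three. So it avoids a fixed separator with probability
    exponentially small in its size, and a union bound over the gates concludes. *)

Set Implicit Arguments.
Unset Strict Implicit.
Unset Printing Implicit Defensive.

(** * Well-linked sets from treewidth *)

Section ParentTree.
Variables (n : nat) (p : nat -> nat).
Hypothesis p_lt : forall i, 0 < i < n.+1 -> p i < i.

Definition parent_edge : rel 'I_n.+1 :=
  fun i j => ((0 < i) && (p i == j)) || ((0 < j) && (p j == i)).

Lemma parent_edge_sym : symmetric parent_edge.
Proof. by move=> i j; rewrite /parent_edge orbC. Qed.

Lemma parent_edge_irr : irreflexive parent_edge.
Proof.
move=> i; rewrite /parent_edge orbb; apply/negP => /andP[i0 /eqP e].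
by have := @p_lt i; rewrite i0 ltn_ord e ltnn => /(_ isT).
Qed.

Definition parent_tree : sgraph := SGraph parent_edge_sym parent_edge_irr.

Lemma parent_edge_le (i j : 'I_n.+1) : parent_edge i j -> j <= i -> p i = j.
Proof.
move=> /orP[/andP[_ /eqP //]|/andP[j0 /eqP e]] ji.
by have := @p_lt j; rewrite j0 ltn_ord e => /(_ isT); rewrite ltnNge ji.
Qed.

(** Parents have smaller indices, so climbing to parents inside [P] must end, and it can end only at
    [r]. *)
Lemma parent_connect (P : pred nat) (r : 'I_n.+1) :
  (forall i : 'I_n.+1, P i -> i != r -> (0 < i) && P (p i)) ->
  forall i : 'I_n.+1, P i ->
  connect [rel x y : 'I_n.+1 | [&& parent_edge x y, P x & P y]] i r.
Proof.
move=> hP i; have [m] := ubnP (val i); elim: m i => // m IH i im Pi.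
have [->|ir] := eqVneq i r; first exact: connect0.
have /andP[i0 Ppi] := hP i Pi ir.
have pi : p i < i by apply: p_lt; rewrite i0 ltn_ord.
have pn : p i < n.+1 by apply: ltn_trans (ltn_ord i).
apply: (connect_trans (y := Ordinal pn)).
  by apply: connect1; rewrite /= Pi Ppi /parent_edge /= i0 eqxx.
by apply: IH => //=; apply: leq_trans pi _.
Qed.

(* The largest vertex of a longer cycle would have two distinct parents. *)
Lemma parent_tree_is_tree : is_tree parent_tree.
Proof.
split=> [|x y|c /andP[cyc Uc]].
- by rewrite card_ord.
- have H : forall z : 'I_n.+1, connect parent_edge z ord0.
    move=> z; apply: (connect_sub _ (@parent_connect predT ord0 _ z isT)) => [u v|i _].
      by rewrite /= !andbT => /connect1.
    by rewrite andbT -val_eqE /= lt0n.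
  apply: connect_trans (H x) _; rewrite sym_connect_sym //; exact: parent_edge_sym.
- rewrite leqNgt; apply/negP => sc.
  have [x0 x0c] : exists x, x \in c by case: c sc {cyc Uc} => // a l _; exists a; rewrite mem_head.
  case: (@arg_maxnP _ x0 (mem c) val x0c) => /= x xc xmax.
  have [i q ec] := rot_to xc.
  have: cycle parent_edge (x :: q) by rewrite -ec rot_cycle.
  have: uniq (x :: q) by rewrite -ec rot_uniq.
  have: size (x :: q) > 2 by rewrite -ec size_rot.
  have qc : {subset x :: q <= c} by move=> y; rewrite -ec mem_rot.
  clear ec; case: q qc => [|y [|z q]] // qc _.
  rewrite /= rcons_path => /and3P[_ yq _] /and3P[xy _ /andP[_ ex]].
  have ly : last z q \in z :: q by apply: mem_last.
  have e1 := parent_edge_le xy; rewrite parent_edge_sym in ex.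
  have e2 := parent_edge_le ex.
  have /e1 f1 : y <= x by apply: xmax; apply: qc; rewrite !inE eqxx orbT.
  have /e2 f2 : last z q <= x by apply: xmax; apply: qc; rewrite !inE -in_cons ly !orbT.
  have : y = last z q by apply: val_inj; rewrite /= -f1 -f2.
  by move=> yl; move: yq; rewrite yl ly.
Qed.
End ParentTree.

Section TreeDecompositions.
Variable H : sgraph.
Implicit Types (s : seq (nat * {set H})) (A B V W X : {set H}).

Definition parent s i := (nth (0, set0) s i).1.
Definition bag s i : {set H} := (nth (0, set0) s i).2.

(* A tree decomposition listed so that parents come before children: each
   vertex enters a bag either from the parent bag or for the first time. *)
Definition bag_list s : Prop :=
  [/\ 0 < size s, forall i, 0 < i < size s -> parent s i < i
    & forall i v, 0 < i < size s -> v \in bag s i ->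
      v \in bag s (parent s i) \/ forall j, j < i -> v \notin bag s j].

Lemma parent_rcons s x i :
  parent (rcons s x) i = if i < size s then parent s i
                         else if i == size s then x.1 else 0.
Proof. by rewrite /parent nth_rcons; case: ltnP => //; case: eqP. Qed.

Lemma bag_rcons s x i :
  bag (rcons s x) i = if i < size s then bag s i
                      else if i == size s then x.2 else set0.
Proof. by rewrite /bag nth_rcons; case: ltnP => //; case: eqP. Qed.

Lemma bag_list_rcons s t V : bag_list s -> t < size s ->
  (forall v i, i < size s -> v \in V -> v \in bag s i -> v \in bag s t) ->
  bag_list (rcons s (t, V)).
Proof.
case=> s0 sp sb ts hV; split; rewrite ?size_rcons //.
  move=> i /andP[i0]; rewrite ltnS leq_eqVlt parent_rcons => /orP[/eqP ->|si].
    by rewrite ltnn eqxx.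
  by rewrite si sp // i0.
move=> i v /andP[i0]; rewrite ltnS leq_eqVlt => /orP[/eqP ->|si].
- rewrite bag_rcons parent_rcons ltnn eqxx /= bag_rcons ts => vV.
  have [/existsP[j vj]|/existsPn nj] := boolP [exists j : 'I_(size s), v \in bag s j].
    by left; apply: hV vj.
  by right=> j js; rewrite bag_rcons js; apply: (nj (Ordinal js)).
- have pi : parent s i < i by apply: sp; rewrite i0.
  rewrite bag_rcons parent_rcons si bag_rcons (ltn_trans pi si) => vi.
  case: (sb i v) => //; first by rewrite i0.
    by left.
  move=> nj; right=> j ji; rewrite bag_rcons (ltn_trans ji si); exact: nj.
Qed.

(** The bags containing [v] form a subtree: following parents from any of them keeps [v] until the
    first bag of the list that contains [v]. *)
Lemma bag_list_width s w m : bag_list s -> is_treewidth H w ->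
  (forall v, exists2 i, i < size s & v \in bag s i) ->
  (forall u v, edge u v -> exists2 i, i < size s & (u \in bag s i) && (v \in bag s i)) ->
  (forall i, #|bag s i| <= m) -> w <= m.-1.
Proof.
move=> [s0 sp sb] [_ tw] cv ce bm.
have es : (size s).-1.+1 = size s by rewrite prednK.
have pl : forall i, 0 < i < (size s).-1.+1 -> parent s i < i by rewrite es.
pose T := parent_tree pl; pose B (t : T) := bag s (val t).
have : tree_decomposition B.
  split.
  - exact: parent_tree_is_tree.
  - move=> v; have [i si vi] := cv v; rewrite -es in si.
    by exists (Ordinal si).
  - move=> u v /ce[i si vi]; rewrite -es in si.
    by exists (Ordinal si).
  - move=> v a b va vb.
    have vaP : exists i, v \in bag s i by exists (val a).
    case: (ex_minnP vaP) => r vr rmin.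
    have rn : r < (size s).-1.+1 by apply: leq_ltn_trans (ltn_ord a); apply: rmin.
    pose e : rel T := [rel x y | [&& edge x y, v \in B x & v \in B y]].
    have C (i : T) : v \in B i -> connect e i (Ordinal rn).
      move=> vi; apply: (@parent_connect _ _ pl (fun j => v \in bag s j) (Ordinal rn)) => // j vj jr.
      have rj : r < j by rewrite ltn_neqAle rmin // andbT eq_sym; move: jr; rewrite -val_eqE.
      have j0 : 0 < j by apply: leq_ltn_trans rj.
      rewrite j0 /=; case: (sb j v) => // [|nj].
        by rewrite j0 (leq_trans (ltn_ord j)) // es.
      by have := nj _ rj; rewrite vr.
    apply: connect_trans (C a va) _; rewrite sym_connect_sym ?C //.
    by move=> x y; rewrite /e /= parent_edge_sym [(v \in B y) && _]andbC.
move/tw => /leq_trans; apply.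
rewrite /width; have : \max_t #|B t| <= m by apply/bigmax_leqP => t _; apply: bm.
by case: m {bm} => [|m]; case: (\max_t _).
Qed.

Definition separation A B : bool :=
  (A :|: B == setT) &&
  [forall x, forall y, (x \notin B) && (y \notin A) ==> ~~ edge x y].

(** The cut form of well-linkedness, dual under Menger's theorem to linkage by disjoint paths. *)
Definition well_linked X : bool :=
  [forall A, forall B, separation A B ==>
    (#|A :&: X| <= #|A :&: B|) || (#|B :&: X| <= #|A :&: B|)].

Definition has_bag (P : pred {set H}) s := has (fun b => P b.2) s.

Lemma has_bagP (P : pred {set H}) s :
  reflect (exists2 i, i < size s & P (bag s i)) (has_bag P s).
Proof. exact: (has_nthP (0, set0)). Qed.

Lemma separation_sym A B : separation A B -> separation B A.
Proof.
move=> /andP[/eqP AB /forallP e]; rewrite /separation setUC AB eqxx.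
apply/forallP=> x; apply/forallP=> y; apply/implyP=> /andP[xA yB].
by rewrite edge_sym; apply: (implyP (forallP (e y) x)); rewrite yB.
Qed.

(* If a separation witnesses that [W] is not well-linked, then trading the part
   of [W] beyond [A] for the separator [A :&: B] makes the boundary smaller. *)
Lemma card_boundary A B V W : separation A B -> #|A :&: B| < #|B :&: W| ->
  #|(W :|: A :&: B :&: V) :&: A| <= #|W| /\ W :\: A != set0.
Proof.
move=> /andP[/eqP AB _] h.
have s1 : #|(W :|: A :&: B :&: V) :&: A| <= #|W :&: A| + #|(A :&: B) :\: W|.
  apply: leq_trans (leq_card_setU _ _); apply: subset_leq_card.
  apply/subsetP=> x; rewrite !inE.
  by case: (x \in W); case: (x \in A); case: (x \in B); case: (x \in V).
have c1 := cardsID A W; have c2 := cardsID W (A :&: B).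
have c3 := cardsID A (B :&: W).
have e3 : B :&: W :&: A = A :&: B :&: W.
  by rewrite setIC setIA.
have e4 : (B :&: W) :\: A = W :\: A.
  apply/setP=> x; have : x \in A :|: B by rewrite AB inE.
  by rewrite !inE; case: (x \in A) => //= ->.
rewrite e3 e4 in c3; split; first by lia.
by rewrite -card_gt0; lia.
Qed.

Lemma extend_subset V W m : W \subset V -> #|W| <= m <= #|V| ->
  exists X : {set H}, [/\ W \subset X, X \subset V & #|X| = m].
Proof.
elim: m => [|m IH] WV /andP[Wm mV].
  by exists W; rewrite subxx WV; split=> //; apply/eqP; rewrite -leqn0.
move: Wm; rewrite leq_eqVlt => /orP[/eqP Wm|Wm]; first by exists W; rewrite subxx.
case: IH => [//||X [WX XV Xm]]; first by apply/andP; split=> //; apply: ltnW.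
have /set0Pn[x] : V :\: X != set0.
  rewrite -card_gt0 cardsD; have := subset_leq_card (subsetIr V X); lia.
rewrite inE => /andP[xX xV]; exists (x |: X); split.
- exact: subset_trans WX (subsetUr _ _).
- by rewrite subUset sub1set xV.
- by rewrite cardsU1 xX Xm.
Qed.

(* The Robertson-Seymour recursion: [W] is the boundary through which [V] meets
   the bags built so far, and the new bags are hung below a bag containing [W]. *)
Lemma bag_list_extend m : (forall X, #|X| = m -> ~~ well_linked X) ->
  forall V W s t, W \subset V -> #|W| <= m -> bag_list s -> t < size s ->
  W \subset bag s t ->
  (forall v, v \in V -> has_bag (fun b : {set H} => v \in b) s -> v \in W) ->
  exists e, [/\ bag_list (s ++ e), forall v, has_bag (fun b : {set H} => v \in b) e -> v \in V,
    forall v, v \in V -> has_bag (fun b : {set H} => v \in b) e,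
    forall u v, u \in V -> v \in V -> edge u v ->
      has_bag (fun b : {set H} => (u \in b) && (v \in b)) e
  & all (fun b : nat * {set H} => #|b.2| <= m.*2) e].
Proof.
move=> nwl V; have [n] := ubnP #|V|; elim: n V => // n IH V Vn W s t WV Wm bs ts Wt VW.
have leaf (N : {set H}) : N \subset V -> bag_list (rcons s (t, N)).
  move=> NV; apply: bag_list_rcons => // v i si vN vi.
  apply: (subsetP Wt); apply: VW; first exact: (subsetP NV).
  by apply/has_bagP; exists i.
have [Vm|mV] := leqP #|V| m.
  exists [:: (t, V)]; rewrite cats1 /has_bag /=; split.
  - exact: leaf.
  - by move=> v; rewrite orbF.
  - by move=> v ->.
  - by move=> u v -> ->.
  - by rewrite andbT -addnn (leq_trans Vm) // leq_addr.
(* Well-linkedness is known to fail only for sets of size exactly [m], so the boundary is padded to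
   that size inside [V]. *)
have [X [WX XV Xm]] := extend_subset WV (introT andP (conj Wm (ltnW mV))).
have := nwl X Xm; rewrite negb_forall => /existsP[A].
rewrite negb_forall => /existsP[B]; rewrite negb_imply negb_or -!ltnNge.
case/and3P=> sepAB hA hB.
(* [N] is the new bag below [t]; the recursion continues in [V :&: A] and [V :&: B] with boundaries
   [N :&: A] and [N :&: B]. *)
pose N := X :|: A :&: B :&: V.
have NV : N \subset V by rewrite subUset XV subsetIr.
have [NA XA] := card_boundary V sepAB hB.
have [NB XB] : #|N :&: B| <= #|X| /\ X :\: B != set0.
  rewrite /N [A :&: B]setIC; apply: card_boundary; first exact: separation_sym.
  by rewrite setIC.
rewrite Xm -/N in NA; rewrite Xm in NB.
have Nm : #|N| <= m.*2.
  rewrite -addnn -{1}Xm; apply: leq_trans (leq_card_setU _ _) _; rewrite leq_add2l.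
  apply: leq_trans (subset_leq_card (subsetIl _ _)) _.
  apply: ltnW; apply: leq_trans hA _; rewrite -Xm; exact: subset_leq_card (subsetIr _ _).
have small (C : {set H}) : X :\: C != set0 -> #|V :&: C| < n.
  case/set0Pn=> x; rewrite inE => /andP[xC xX]; apply: (@leq_trans #|V|) => //.
  apply: proper_card; rewrite properE subsetIl; apply/subsetPn; exists x.
    exact: (subsetP XV).
  by rewrite inE (negPf xC) andbF.
have szs : size s < size (rcons s (t, N)) by rewrite size_rcons.
have bN : bag (rcons s (t, N)) (size s) = N by rewrite bag_rcons ltnn eqxx.
have [||eA [blA subA covA edgA szA]] := IH (V :&: A) (small A XA) (N :&: A) _ (size s)
  (setSI A NV) NA (leaf N NV) szs.
  - by rewrite bN subsetIl.
  - move=> v; rewrite inE => /andP[vV vA]; rewrite /has_bag has_rcons [v \in _ :&: A]inE vA andbT /=.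
    by case/orP=> // vs; rewrite inE (subsetP WX) // VW.
have szA' : size s < size (rcons s (t, N) ++ eA) by rewrite size_cat ltn_addr.
have bNA : bag (rcons s (t, N) ++ eA) (size s) = N.
  by rewrite /bag nth_cat szs -/(bag _ _) bN.
have [||eB [blB subB covB edgB szB]] := IH (V :&: B) (small B XB) (N :&: B) _ (size s)
  (setSI B NV) NB blA szA'.
  - by rewrite bNA subsetIl.
  - move=> v; rewrite inE => /andP[vV vB].
    rewrite /has_bag has_cat has_rcons [v \in _ :&: B]inE vB andbT /= -orbA.
    case/or3P=> [//|vs|/subA]; first by rewrite inE (subsetP WX) // VW.
    by rewrite !inE vB vV => /andP[_ ->]; rewrite orbT.
have inAB v : (v \in A) || (v \in B).
  by case/andP: sepAB => /eqP AB _; rewrite -in_setU AB inE.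
exists ((t, N) :: eA ++ eB); rewrite -catA cat_rcons in blB.
split=> //.
- move=> v; rewrite /has_bag /= has_cat => /or3P[|/subA|/subB].
  + exact: (subsetP NV).
  + by rewrite inE => /andP[].
  + by rewrite inE => /andP[].
- move=> v vV; rewrite /has_bag /= has_cat.
  case/orP: (inAB v) => vAB.
    by rewrite [has _ eA]covA ?orbT // inE vV.
  by rewrite [has _ eB]covB ?orbT // inE vV.
- move=> u v uV vV uv; rewrite /has_bag /= has_cat.
  have [/andP[uA vA]|nA] := boolP ((u \in A) && (v \in A)).
    by rewrite [has _ eA]edgA ?orbT // inE ?uV ?vV.
  have [/andP[uB vB]|nB] := boolP ((u \in B) && (v \in B)).
    by rewrite [has _ eB]edgB ?orbT // inE ?uV ?vV.
  (* Otherwise [u] and [v] lie strictly on opposite sides, where the separation forbids an edge. *)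
  case/andP: sepAB => _ /forallP sep.
  have /forallP/(_ v) := sep u; have /forallP/(_ u) := sep v.
  rewrite [edge v u]edge_sym uv !implybF; move: (inAB u) (inAB v) nA nB.
  by case: (u \in A); case: (u \in B); case: (v \in A); case: (v \in B).
- by rewrite /= Nm all_cat szA szB.
Qed.

(** If no set of size [w./2] were well-linked, the recursion started at an empty root would give
    bags of size at most [w./2.*2 <= w], hence width below [w]. *)
Lemma treewidth_well_linked w : is_treewidth H w ->
  exists2 X : {set H}, #|X| = w./2 & well_linked X.
Proof.
(* Since [.-1] truncates at 0, the final contradiction needs [w./2] to be positive. *)
move=> tw; have [->|w2] := posnP w./2.
  exists set0; rewrite ?cards0 //; apply/forallP=> A; apply/forallP=> B.
  by rewrite setI0 cards0 implybT.
have [/existsP[X /andP[/eqP Xw wl]]|/existsPn nX] :=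
  boolP [exists X : {set H}, (#|X| == w./2) && well_linked X]; first by exists X.
have nwl X : #|X| = w./2 -> ~~ well_linked X.
  by move=> Xw; have := nX X; rewrite Xw eqxx.
have bl0 : bag_list [:: (0, set0)] by split=> //; case.
have [||||v _|e [bl _ cov edg sz]] :=
    @bag_list_extend w./2 nwl setT set0 [:: (0, set0)] 0 _ _ bl0.
- exact: sub0set.
- by rewrite cards0.
- by [].
- exact: sub0set.
- by rewrite /has_bag /= inE.
have : w <= (w./2.*2).-1.
  apply: (bag_list_width bl tw).
  - move=> v; apply/(has_bagP (fun b : {set H} => v \in b)); rewrite /has_bag has_cat orbC [has _ e]cov //.
  - move=> u v uv; apply/(has_bagP (fun b : {set H} => (u \in b) && (v \in b))).
    by rewrite /has_bag has_cat orbC [has _ e]edg.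
  - move=> i; have [si|si] := ltnP i (size ([:: (0, set0)] ++ e)); last first.
      by rewrite /bag nth_default // cards0.
    have /all_nthP : all (fun b : nat * {set H} => #|b.2| <= w./2.*2) ([:: (0, set0)] ++ e).
      by rewrite all_cat sz /= cards0.
    exact.
lia.
Qed.
End TreeDecompositions.

(** * Induced minor models *)

Definition edge_in (G : sgraph) (B : {set G}) : rel G :=
  [rel x y | [&& edge x y, x \in B & y \in B]].

Definition touch (G : sgraph) (A B : {set G}) : bool :=
  [exists u in A, exists v in B, edge u v].

(** The equality in the last clause is what makes the minor induced. *)
Definition minor_model (H G : sgraph) (B : H -> {set G}) : Prop :=
  [/\ forall h, B h != set0,
      forall h, {in B h &, forall x y, connect (edge_in (B h)) x y},
      forall h k x, x \in B h -> x \in B k -> h = k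
    & forall h k, h != k -> edge h k = touch (B h) (B k)].

Section Basics.
Variable G : sgraph.
Implicit Types A B : {set G}.

Lemma touchP A B :
  reflect (exists u v, [/\ u \in A, v \in B & edge u v]) (touch A B).
Proof.
apply: (iffP existsP) => [[u /andP[uA /existsP[v /andP[vB uv]]]]|[u [v [uA vB uv]]]].
  by exists u, v.
by exists u; rewrite uA; apply/existsP; exists v; rewrite vB.
Qed.

Lemma edge_in_sym B : symmetric (edge_in B).
Proof. by move=> x y; rewrite /edge_in /= edge_sym [(y \in B) && _]andbC. Qed.

Lemma edge_in_connect_sym B : connect_sym (edge_in B).
Proof. exact: sym_connect_sym (@edge_in_sym B). Qed.

Lemma edge_in_sub A B x y : A \subset B ->
  connect (edge_in A) x y -> connect (edge_in B) x y.
Proof.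
move=> AB; apply: connect_sub => u v /and3P[uv uA vA]; apply: connect1.
by rewrite /edge_in /= uv !(subsetP AB).
Qed.

End Basics.

(** A single deletion or contraction has an explicit model; composing models treats a whole sequence
    of them. *)
Lemma minor_model_trans (H G G' : sgraph) (B : H -> {set G'}) (F : G' -> {set G}) :
  minor_model B -> minor_model F ->
  minor_model (fun h => \bigcup_(x in B h) F x).
Proof.
move=> [B0 Bc Bd Be] [F0 Fc Fd Fe]; split.
- move=> h; have /set0Pn[x xB] := B0 h; have /set0Pn[y yF] := F0 x.
  by apply/set0Pn; exists y; apply/bigcupP; exists x.
- move=> h x y /bigcupP[a aB xa] /bigcupP[b bB yb].
  set U := \bigcup_(x in B h) F x.
  have FU c : c \in B h -> F c \subset U by move=> cB; apply: (bigcup_sup c).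
  (* A walk in [B h] is lifted to [G]: each of its steps crosses an edge between two touching sets
     [F a] and [F c]. *)
  have /connectP[p pp lp] := Bc h a b aB bB.
  elim: p a x aB xa pp lp => [|c p IH] a x aB xa /=.
    move=> _ ba; rewrite ba in yb; exact: edge_in_sub (FU a aB) (Fc a x y xa yb).
  case/andP=> /and3P[ac _ cB] pp lp.
  have : touch (F a) (F c) by rewrite -Fe //; apply: contraTneq ac => ->; rewrite edge_irr.
  case/touchP=> u [v [ua vc uv]].
  apply: connect_trans (edge_in_sub (FU a aB) (Fc a x u xa ua)) _.
  apply: (@connect_trans _ _ v); last exact: (IH c).
  by apply: connect1; rewrite /edge_in /= uv (subsetP (FU a aB)) ?(subsetP (FU c cB)).
- move=> h k x /bigcupP[a aB xa] /bigcupP[b bB xb].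
  by rewrite (Fd _ _ _ xa xb) in aB; apply: Bd aB bB.
- move=> h k hk; rewrite Be //; apply/touchP/touchP.
    move=> [a [b [aB bB ab]]].
    have : touch (F a) (F b) by rewrite -Fe //; apply: contraTneq ab => ->; rewrite edge_irr.
    by case/touchP=> u [v [ua vb uv]]; exists u, v; split=> //; apply/bigcupP; [exists a|exists b].
  move=> [u [v [/bigcupP[a aB ua] /bigcupP[b bB vb] uv]]]; exists a, b; split=> //.
  rewrite Fe; first by apply/touchP; exists u, v.
  by apply: contraNneq hk => e; rewrite e in aB; rewrite (Bd _ _ _ aB bB).
Qed.

Lemma iso_minor_model (H G : sgraph) : giso H G ->
  exists B : H -> {set G}, minor_model B.
Proof.
case=> f [/bij_inj fi fe]; exists (fun h => [set f h]); split.
- by move=> h; apply/set0Pn; exists (f h); rewrite inE.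
- by move=> h x y /set1P -> /set1P ->; apply: connect0.
- by move=> h k x /set1P -> /set1P /fi.
- move=> h k _; rewrite -fe; apply/idP/touchP; first by exists (f h), (f k); rewrite !inE.
  by move=> [u [v [/set1P -> /set1P ->]]].
Qed.

Lemma delv_minor_model (G : sgraph) (v : G) :
  minor_model (fun x : delv v => [set val x]).
Proof.
split.
- by move=> h; apply/set0Pn; exists (val h); rewrite inE.
- by move=> h x y /set1P -> /set1P ->; apply: connect0.
- by move=> h k x /set1P -> /set1P /val_inj.
- move=> h k _; apply/idP/touchP; first by exists (val h), (val k); rewrite !inE.
  by move=> [a [b [/set1P -> /set1P ->]]].
Qed.

Lemma contract_minor_model (G : sgraph) (u v : G) : edge u v ->
  minor_model (fun x : contract u v => if val x == u then [set u; v] else [set val x]).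
Proof.
move=> uv; set F := fun x => _.
have FP (x : contract u v) y : (y \in F x) = (y == val x) || (val x == u) && (y == v).
  by rewrite /F; case: (eqVneq (val x) u) => [->|]; rewrite !inE ?orbF.
have vv (x : contract u v) : (val x == v) = false by apply/negbTE/(valP x).
split.
- by move=> h; apply/set0Pn; exists (val h); rewrite FP eqxx.
- move=> h x y; rewrite !FP.
  have sv : (val h == u) -> edge_in (F h) (val h) v.
    by move=> hu; rewrite /edge_in /= !FP hu !eqxx orbT (eqP hu) uv.
  case/orP=> [/eqP ->|/andP[hu /eqP ->]] /orP[/eqP ->|/andP[hu' /eqP ->]] //.
  + by apply: connect1; apply: sv.
  + by rewrite edge_in_connect_sym; apply: connect1; apply: sv.
- move=> h k x; rewrite !FP.
  case/orP=> [/eqP ->|/andP[/eqP hu /eqP ->]] /orP[/eqP e|/andP[/eqP hu' /eqP e]].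
  + exact: val_inj.
  + by have := vv h; rewrite e eqxx.
  + by have := vv k; rewrite -e eqxx.
  + by apply: val_inj; rewrite /= hu hu'.
- move=> h k hk; rewrite /edge /= /contract_edge /= hk /=; apply/idP/touchP.
  + case/or3P=> [e|/andP[hu e]|/andP[ku e]].
    * by exists (val h), (val k); rewrite !FP !eqxx.
    * by exists v, (val k); rewrite !FP !eqxx hu orbT.
    * by exists (val h), v; rewrite !FP !eqxx ku orbT edge_sym.
  + move=> [x [y []]]; rewrite !FP.
    case/orP=> [/eqP ->|/andP[hu /eqP ->]] /orP[/eqP ->|/andP[ku /eqP ->]].
    * by move=> ->.
    * by rewrite edge_sym ku => ->; rewrite !orbT.
    * by rewrite hu => ->; rewrite orbT.
    * by rewrite edge_irr.
Qed.

Lemma induced_minor_model (H G : sgraph) : induced_minor H G ->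
  exists B : H -> {set G}, minor_model B.
Proof.
elim=> [{}G /iso_minor_model //|{}G v _ [B mB]|{}G u v uv _ [B mB]].
  by eexists; apply: minor_model_trans mB (@delv_minor_model G v).
by eexists; apply: minor_model_trans mB (contract_minor_model uv).
Qed.

(* Along a shortest path only consecutive vertices are adjacent, so the vertices
   in even and in odd position form two independent sets. *)
Lemma shortest_path_split (G : sgraph) (B : {set G}) (p : seq G) (x : G) :
  x \in B -> path (edge_in B) x p ->
  (forall q, path (edge_in B) x q -> last x q = last x p -> size p <= size q) ->
  exists S T : {set G}, [/\ independent S, independent T,
    S :|: T = [set z in x :: p], x \in S & {subset T <= p}].
Proof.
elim: p x => [|z p IH] x xB /=.
  exists [set x], set0; split.
  - by move=> a b /set1P -> /set1P ->; rewrite edge_irr.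
  - by move=> a b; rewrite inE.
  - by rewrite setU0; apply/setP=> y; rewrite !inE.
  - by rewrite inE.
  - by move=> y; rewrite inE.
case/andP=> /and3P[xz _ zB] zp mn.
have [|S [T [iS iT eST zS Tp]]] := IH z zB zp.
  move=> q zq lq; rewrite -ltnS; apply: (mn (z :: q)) => //=.
  by rewrite /edge_in /= xz xB zB.
have pB y : y \in p -> y \in B.
  elim: p z zp {IH xz zB mn eST zS Tp} => // a p IH z /= /andP[/and3P[_ _ aB] ap].
  by rewrite inE => /orP[/eqP ->|] //; apply: IH ap.
(* An edge from [x] to a vertex of [p] would shortcut the path. So [x] can join [T], and the two
   classes swap roles. *)
have xT y : y \in T -> ~~ edge x y.
  move=> /Tp yp; apply/negP=> xy; have yB := pB y yp.
  move: yp zp mn => {IH eST Tp pB} /splitPr[q1 q2].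
  rewrite cat_path last_cat /= => /and3P[_ _ yq2] /(_ (y :: q2)) /=.
  rewrite {1}/edge_in /= xy xB yB yq2 => /(_ isT erefl).
  by rewrite size_cat /=; lia.
exists (x |: T), S; split=> //.
- move=> a b /setU1P[->|aT] /setU1P[->|bT]; rewrite ?edge_irr ?xT //.
  + by rewrite edge_sym xT.
  + exact: iT.
- rewrite -setUA [T :|: S]setUC eST; apply/setP=> y; by rewrite !inE.
- exact: setU11.
- move=> y yS; have : y \in S :|: T by rewrite inE yS.
  by rewrite eST inE.
Qed.

Lemma connect_path_split (G : sgraph) (B : {set G}) (x y : G) :
  x \in B -> connect (edge_in B) x y ->
  exists S T : {set G}, [/\ independent S /\ independent T, x \in S, y \in S :|: T,
    S :|: T \subset B
  & forall v, v \in S :|: T -> connect (edge_in (S :|: T)) x v].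
Proof.
move=> xB /connectP[p0 pp0 lp0].
pose P n := [exists p : n.-tuple G, path (edge_in B) x p && (last x p == y)].
have exP : exists n, P n.
  by exists (size p0); apply/existsP; exists (in_tuple p0); rewrite pp0 lp0 eqxx.
case: (ex_minnP exP) => n /existsP[p /andP[pp /eqP lp]] nmin.
have [|S [T [iS iT eST xS Tp]]] := @shortest_path_split G B p x xB pp.
  move=> q pq lq; rewrite size_tuple; apply: nmin; apply/existsP; exists (in_tuple q).
  by rewrite /= pq lq lp eqxx.
have STB : S :|: T \subset B.
  rewrite eST; apply/subsetP=> v; rewrite inE.
  elim: (val p) (x) xB pp => [|a q IH] z zB /=; first by rewrite inE => _ /eqP ->.
  case/andP=> /and3P[_ _ aB] aq; rewrite inE => /orP[/eqP -> //|]; exact: IH aq.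
exists S, T; split=> //.
  by rewrite eST inE -lp mem_last.
move=> v; rewrite eST inE => vp.
have : path (edge_in [set z in x :: p]) x p.
  apply: (@sub_in_path _ (mem (x :: p)) (edge_in B)) => //; last by apply/allP.
  by move=> a b ap bp /and3P[ab _ _]; rewrite /edge_in /= ab !in_set [a \in _]ap [b \in _]bp.
move: (edge_in [set z in x :: p]) => e.
move: (val p) vp => q; case/splitPl=> p1 p2 lv; rewrite cat_path => /andP[pp1 _].
by apply/connectP; exists p1.
Qed.

Lemma touch_sym (G : sgraph) (A B : {set G}) : touch A B = touch B A.
Proof. by apply/touchP/touchP => [] [u [v [uA vB uv]]]; exists v, u; rewrite edge_sym. Qed.

Lemma touch_sub (G : sgraph) (A A' B : {set G}) : A \subset A' -> touch A B -> touch A' B.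
Proof.
by move=> AA /touchP[u [v [uA vB uv]]]; apply/touchP; exists u, v; rewrite (subsetP AA).
Qed.

(** The classes are indexed, possibly with repetition, so that one can be drawn uniformly; being
    nonempty, every drawn class meets [B]. *)
Definition independent_cover (G : sgraph) (n : nat) (I : 'I_n -> {set G}) (B : {set G}) :=
  [/\ forall c, I c \subset B, forall c, I c != set0, forall c, independent (I c)
    & forall v, v \in B -> exists c, v \in I c].

(* Shrink the branch set of [h] to a union of shortest paths from one of its
   vertices to a contact vertex of each neighbouring branch set. *)
Lemma shrink_branch_set (H G : sgraph) (d : nat) (B : H -> {set G}) (h : H) :
  minor_model B -> #|[set k | edge h k]| <= d ->
  exists (Q : {set G}) (I : 'I_(d.*2.+1) -> {set G}),
    minor_model (fun k => if k == h then Q else B k) /\ independent_cover I Q.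
Proof.
move=> [B0 Bc Bd Be] deg; have /set0Pn[t tB] := B0 h.
have /fin_all_exists[st stP] : forall k : H, exists st : {set G} * {set G}, edge h k ->
    [/\ independent st.1 /\ independent st.2, t \in st.1, touch (st.1 :|: st.2) (B k),
      st.1 :|: st.2 \subset B h
    & forall v, v \in st.1 :|: st.2 -> connect (edge_in (st.1 :|: st.2)) t v].
  move=> k; have [hk|_] := boolP (edge h k); last by exists (set0, set0).
  have : touch (B h) (B k) by rewrite -Be //; apply: contraTneq hk => ->; rewrite edge_irr.
  case/touchP=> u [v [uB vB uv]].
  have [S [T [iST tS uST STB con]]] := connect_path_split tB (Bc h t u tB uB).
  by exists (S, T) => _; split=> //; apply/touchP; exists u, v.
pose N := [set k | edge h k].
pose Q := t |: \bigcup_(k in N) ((st k).1 :|: (st k).2).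
have tQ : t \in Q by rewrite setU11.
have stQ k : edge h k -> (st k).1 :|: (st k).2 \subset Q.
  by move=> hk; apply: subset_trans (subsetUr _ _); apply: (bigcup_sup k); rewrite ?inE.
have QB : Q \subset B h.
  rewrite subUset sub1set tB; apply/bigcupsP => k; rewrite inE => /stP[] //.
(* Two classes for each of at most [d] paths, together with [[set t]], give the bound [d.*2.+1]. *)
pose F := [set t] |: ((fun k => (st k).1) @: N :|: (fun k => (st k).2) @: N).
have cF : #|F| <= d.*2.+1.
  apply: leq_trans (leq_card_setU _ _) _; rewrite cards1 add1n ltnS -addnn.
  apply: leq_trans (leq_card_setU _ _) _.
  by apply: leq_add; apply: leq_trans (leq_imset_card _ _) deg.
have FP X : X \in F -> independent X /\ X \subset Q.
  case/setU1P=> [->|/setUP[]/imsetP[k]]; rewrite ?inE.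
  - by rewrite sub1set tQ; split=> // a b /set1P -> /set1P ->; rewrite edge_irr.
  - move=> hk ->; have [[i1 i2] _ _ _ _] := stP k hk; split=> //.
    exact: subset_trans (subsetUl _ _) (stQ k hk).
  - move=> hk ->; have [[i1 i2] _ _ _ _] := stP k hk; split=> //.
    exact: subset_trans (subsetUr _ _) (stQ k hk).
have Ft : [set t] \in F by rewrite setU11.
have nF (c : 'I_(d.*2.+1)) : nth [set t] (enum F) c \in F.
  have [cs|cs] := ltnP c (size (enum F)); first by rewrite -mem_enum mem_nth.
  by rewrite nth_default.
(* Indices beyond [F] and empty classes fall back to [[set t]]. *)
pose I (c : 'I_(d.*2.+1)) :=
  let X := nth [set t] (enum F) c in if X == set0 then [set t] else X.
have IF c : I c \in F by rewrite /I; case: ifP.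
exists Q, I; split; last first.
  split=> [c|c|c|v vQ].
  - by have [] := FP _ (IF c).
  - by rewrite /I; case: ifP => [_|/negbT //]; apply/set0Pn; exists t; rewrite inE.
  - by have [] := FP _ (IF c).
  - have [X XF vX] : exists2 X, X \in F & v \in X.
      case/setU1P: vQ => [->|/bigcupP[k kN /setUP[]vk]]; first by exists [set t]; rewrite ?set11.
        by exists (st k).1 => //; apply/setU1r/setUP; left; apply: imset_f.
      by exists (st k).2 => //; apply/setU1r/setUP; right; apply: imset_f.
    have XE : X \in enum F by rewrite mem_enum.
    have Xi : index X (enum F) < d.*2.+1.
      by apply: leq_trans cF; rewrite cardE index_mem.
    exists (Ordinal Xi); rewrite /I /= nth_index //.
    by case: eqP => // X0; rewrite X0 inE in vX.
have touchQ k : k != h -> touch Q (B k) = touch (B h) (B k).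
  move=> kh; apply/idP/idP; first exact: touch_sub.
  rewrite -Be ?[h == k]eq_sym // => hk; have [_ _ tk _ _] := stP k hk.
  exact: touch_sub (stQ k hk) tk.
split.
- by move=> k; case: ifP => // _; apply/set0Pn; exists t.
- move=> k; case: ifP => // _ x y xQ yQ.
  suff con z : z \in Q -> connect (edge_in Q) t z.
    by apply: connect_trans (con y yQ); rewrite edge_in_connect_sym con.
  case/setU1P=> [->|/bigcupP[l]]; first exact: connect0.
  rewrite inE => hl zl; have [_ _ _ _ con] := stP l hl.
  exact: edge_in_sub (stQ l hl) (con z zl).
- move=> k l x; case: eqP => [->|_]; case: eqP => [->|_] //.
  + by move=> /(subsetP QB) xB; apply: Bd.
  + by move=> xk /(subsetP QB); apply: Bd.
  + exact: Bd.
- move=> k l; case: (eqVneq k h) => [->|kh]; case: (eqVneq l h) => [->|lh] //.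
  + by move=> _; rewrite touchQ // Be // eq_sym.
  + by move=> _; rewrite touch_sym touchQ // touch_sym Be.
  + exact: Be.
Qed.

(** Branch sets are shrunk one after the other; shrinking one leaves the others and their covers
    unchanged. *)
Lemma induced_minor_cover (H G : sgraph) (d : nat) :
  induced_minor H G -> max_degree H <= d ->
  exists (B : H -> {set G}) (I : H -> 'I_(d.*2.+1) -> {set G}),
    minor_model B /\ forall h, independent_cover (I h) (B h).
Proof.
move=> /induced_minor_model[B mB] deg.
suff: exists (B : H -> {set G}) (I : H -> 'I_(d.*2.+1) -> {set G}),
    minor_model B /\ forall h, h \in enum H -> independent_cover (I h) (B h).
  by case=> B' [I [mB' IB]]; exists B', I; split=> // h; apply: IB; rewrite mem_enum.
elim: (enum H) => [|h s [B' [I [mB' IB]]]]; first by exists B, (fun _ _ => set0).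
have hd : #|[set k | edge h k]| <= d.
  by apply: leq_trans deg; apply: (leq_bigmax (F := fun v : H => #|[set u | edge v u]|)).
have [Q [J [mQ JQ]]] := shrink_branch_set mB' hd.
exists (fun k => if k == h then Q else B' k), (fun k => if k == h then J else I k).
split=> // k; rewrite inE; case: eqP => [_ _ //|_ /=]; exact: IB.
Qed.

(** * Balanced gates *)

Section Circuits.
Local Open Scope mset_scope.
Variables (G : sgraph) (C : tropical_circuit G).
Implicit Types (g : gate C) (m n : {mset G}) (I Y : {set G}).

(** A context completes every monomial of [g], not just the one in a given parse tree, so monomials
    and contexts of a gate combine freely. *)
Definition gate_context g n := forall m, monomial_at g m -> computed C (m `+` n).

Definition weight Y m := \sum_(v in Y) m v.

Lemma weightD Y m n : weight Y (m `+` n) = weight Y m + weight Y n.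
Proof. by rewrite /weight -big_split; apply: eq_bigr => v _; rewrite msetE2. Qed.

Lemma weight_mset1 Y (x : G) : weight Y [mset x] <= 1.
Proof.
rewrite /weight; have [xY|xY] := boolP (x \in Y).
  rewrite (bigD1 x) //= msetnE eqxx big1 // => v /andP[_ /negbTE vx].
  by rewrite msetnE vx.
rewrite big1 // => v vY; rewrite msetnE; case: eqP => // vx.
by rewrite -vx vY in xY.
Qed.

Lemma set_monomialE I v : set_monomial I v = (v \in I) :> nat.
Proof. by rewrite /set_monomial mset_seqE count_uniq_mem ?enum_uniq // mem_enum. Qed.

Lemma weight_set_monomial I Y : Y \subset I -> weight Y (set_monomial I) = #|Y|.
Proof.
move=> YI; rewrite /weight -sum1_card; apply: eq_bigr => v vY.
by rewrite set_monomialE (subsetP YI).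
Qed.

Lemma weight_le m (U : {set G}) : (forall v, m v <= 1) -> (forall v, 0 < m v -> v \in U) ->
  forall Y, weight Y m <= #|Y :&: U|.
Proof.
move=> m1 mU Y; rewrite -sum1_card (eq_bigl (fun v => (v \in Y) && (v \in U))); last first.
  by move=> v; rewrite inE.
rewrite big_mkcondr; apply: leq_sum => v _; case: ifP => // vU.
by rewrite leqNgt; apply/negP=> /mU; rewrite vU.
Qed.

(* Descend from a heavy gate into the heavier child until the weight first
   drops to at most two thirds. *)
Lemma balanced_gate Y T g m : 2 <= T -> monomial_at g m ->
  forall n, gate_context g n -> 2 * T < 3 * weight Y m ->
  exists g' m' n', [/\ monomial_at g' m', gate_context g' n', m' `+` n' = m `+` n,
    T <= 3 * weight Y m' & 3 * weight Y m' <= 2 * T].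
Proof.
move=> T2; elim=> {g m} [g x _|g _|g a b m lg _ IH|g a b m lg _ IH|
    g a b m1 m2 lg ma IHa mb IHb] n cn wm.
(* A leaf weighs at most 1, and [2 <= T] rules out [2 * T < 3]. *)
- by have := weight_mset1 Y x; lia.
- move: wm; rewrite /weight big1 // => v _; exact: mset0E.
- by apply: IH => // k ak; apply: cn; apply: MonMaxl lg ak.
- by apply: IH => // k bk; apply: cn; apply: MonMaxr lg bk.
(* The monomial of the other child joins the context. *)
- have ca : gate_context a (m2 `+` n).
    by move=> k ak; rewrite msetDA; apply: cn; apply: MonPlus lg ak mb.
  have cb : gate_context b (m1 `+` n).
    move=> k bk; rewrite msetDA [k `+` m1]msetDC; apply: cn; exact: MonPlus lg ma bk.
  have ea : m1 `+` (m2 `+` n) = m1 `+` m2 `+` n by rewrite msetDA.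
  have eb : m2 `+` (m1 `+` n) = m1 `+` m2 `+` n by rewrite msetDA [m2 `+` m1]msetDC.
  rewrite weightD in wm.
  (* The heavier child weighs more than [T / 3], so the descent stops there unless it weighs more
     than [2 T / 3]. *)
  have [wba|wab] := leqP (weight Y m2) (weight Y m1).
    have [wa|wa] := leqP (3 * weight Y m1) (2 * T).
      by exists a, m1, (m2 `+` n); split=> //; lia.
    by have [g' [m' [n' [? ? e ? ?]]]] := IHa _ ca wa; exists g', m', n'; rewrite -ea.
  have [wb|wb] := leqP (3 * weight Y m2) (2 * T).
    by exists b, m2, (m1 `+` n); split=> //; lia.
  by have [g' [m' [n' [? ? e ? ?]]]] := IHb _ cb wb; exists g', m', n'; rewrite -eb.
Qed.

(** [U g] collects the variables of monomials at [g], [W g] those of its contexts. A monomial times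
    a context is an independent set with exponents 1, so the two are disjoint and have no edge
    between them. *)
Lemma MWIS_circuit_balanced : MWIS_circuit C ->
  exists U W : gate C -> {set G},
    (forall g u v, u \in U g -> v \in W g -> (u != v) && ~~ edge u v) /\
    (forall I Y, independent I -> Y \subset I -> 2 <= #|Y| ->
       exists g, [/\ I \subset U g :|: W g, #|Y| <= 3 * #|Y :&: U g|
                   & #|Y| <= 3 * #|Y :&: W g|]).
Proof.
case=> sound complete.
exists (fun g => [set v | `[< exists2 m, monomial_at g m & v \in m >]]),
  (fun g => [set v | `[< exists2 n, gate_context g n & v \in n >]]).
split=> [g u v|I Y iI YI Y2].
  rewrite !inE => /asboolP[m gm um] /asboolP[n gn vn].
  have [I iI e] := sound _ (gn m gm).
  have E x : m x + n x = (x \in I) by rewrite -set_monomialE -e msetE2.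
  rewrite in_mset in um; rewrite in_mset in vn.
  have uI : u \in I by have := E u; case: (u \in I) => //; lia.
  have vI : v \in I by have := E v; case: (v \in I) => //; lia.
  rewrite iI // andbT; apply/eqP=> uv; have := E u; rewrite uI -uv in vn *; lia.
have c0 : gate_context (output C) mset0 by move=> m; rewrite msetD0.
have wI := weight_set_monomial YI.
have [|g [m [n [gm gn e lo hi]]]] := balanced_gate Y2 (complete I iI) c0 (Y := Y).
  by rewrite wI; lia.
rewrite msetD0 in e.
have E x : m x + n x = (x \in I) by rewrite -set_monomialE -e msetE2.
set U := [set v | `[< exists2 m, monomial_at g m & v \in m >]].
set W := [set v | `[< exists2 n, gate_context g n & v \in n >]].
have mU v : 0 < m v -> v \in U.
  by move=> mv; rewrite inE; apply/asboolP; exists m; rewrite ?in_mset.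
have nW v : 0 < n v -> v \in W.
  by move=> nv; rewrite inE; apply/asboolP; exists n; rewrite ?in_mset.
have m1 v : m v <= 1 by have := E v; case: (v \in I); lia.
have n1 v : n v <= 1 by have := E v; case: (v \in I); lia.
have wm := weight_le m1 mU; have wn := weight_le n1 nW.
have wD : weight Y m + weight Y n = #|Y| by rewrite -weightD e.
exists g; rewrite -/U -/W; split; last first.
- by have := wn Y; lia.
- by have := wm Y; lia.
apply/subsetP=> v vI; have := E v; rewrite vI inE => mn.
by have [m0|/mU ->//] := posnP (m v); rewrite nW ?orbT //; lia.
Qed.

(** Acyclicity makes a lone gate a leaf, with a single monomial, while the empty set and [[set v]]
    require two. *)
Lemma card_gate_gt1 (v : G) : MWIS_circuit C -> 1 < #|gate C|.
Proof.
case=> _ complete; rewrite ltnNge; apply/negP => /card_le1_eqP one.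
have eqg g g' : g = g' by apply: one.
have ac g : ~~ feeds (@label _ C) g g.
  by apply/negP=> gg; have := @circuit_acyclic _ C [:: g]; rewrite /= gg => /(_ isT).
have c0 : computed C (set_monomial set0) by apply: complete => x y; rewrite inE.
have c1 : computed C (set_monomial [set v]).
  by apply: complete => x y /set1P -> /set1P ->; rewrite edge_irr.
have leaf g m : monomial_at g m ->
    label g = LZero /\ m = mset0 \/ exists2 x, label g = LVar x & m = [mset x].
  case=> {g m} g.
  - by move=> x l; right; exists x.
  - by left.
  - by move=> a b k l; have := ac g; rewrite /feeds /= l (eqg a g) eqxx.
  - by move=> a b k l; have := ac g; rewrite /feeds /= l (eqg a g) eqxx.
  - by move=> a b k k' l; have := ac g; rewrite /feeds /= l (eqg a g) eqxx.
have h0 : set_monomial (@set0 G) v = 0 by rewrite set_monomialE inE.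
have h1 : set_monomial [set v] v = 1 by rewrite set_monomialE inE eqxx.
case: (leaf _ _ c0) => [[l0 e0]|[x l0 e0]]; case: (leaf _ _ c1) => [[l1 e1]|[y l1 e1]].
- by rewrite e1 mset0E in h1.
- by rewrite l0 in l1.
- by rewrite l0 in l1.
- by move: l1 h0 h1; rewrite l0 e0 e1 => -[->] ->.
Qed.
End Circuits.

(** * Independence and packings *)

Section ProductSpace.
Variables T K : finType.
Local Notation space := {ffun T -> K}.
Implicit Types (D : {set T}) (A B : {set space}) (f g : space).

Definition depends_on D A : Prop :=
  forall f g, {in D, f =1 g} -> (f \in A) = (g \in A).

Definition mix D f g : space := [ffun x => if x \in D then f x else g x].

(* [(A :&: B) * space] and [A * B] are exchanged by swapping the coordinates
   outside [D]. *)
Lemma card_independent D A B : depends_on D A -> depends_on (~: D) B ->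
  #|A :&: B| * #|space| = #|A| * #|B|.
Proof.
move=> dA dB; pose F (p : space * space) := (mix D p.1 p.2, mix D p.2 p.1).
have FK : involutive F.
  by case=> f g; congr pair; apply/ffunP=> x; rewrite !ffunE; case: (x \in D).
rewrite -cardsT -!cardsX -(card_imset _ (inv_inj FK)) (can2_imset_pre _ FK FK).
apply: eq_card => -[f g]; rewrite !inE /= andbT; congr (_ && _).
  by apply: dA => x xD; rewrite ffunE xD.
by apply: dB => x; rewrite inE ffunE => /negbTE ->.
Qed.

(** Events on pairwise disjoint sets of coordinates are independent, so the failure bounds
    [1 - 1 / q] multiply. Denominators are cleared to stay in [nat]. *)
Lemma card_avoid (J : eqType) (D : J -> {set T}) (E : J -> {set space}) q (s : seq J) :
  0 < q -> uniq s ->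
  {in s, forall i, depends_on (D i) (E i) /\ #|space| <= q * #|E i|} ->
  {in s &, forall i j x, x \in D i -> x \in D j -> i = j} ->
  #|[set f | all (fun i => f \notin E i) s]| * q ^ size s <= #|space| * q.-1 ^ size s.
Proof.
move=> q0; elim: s => [|i s IH] /=; first by rewrite !muln1 => _ _ _; apply: max_card.
case/andP=> iNs Us hE hD.
have {}IH : #|[set f | all (fun i => f \notin E i) s]| * q ^ size s <=
    #|space| * q.-1 ^ size s.
  apply: IH => // [j js|j k js ks]; first by apply: hE; rewrite inE js orbT.
  by apply: hD; rewrite inE ?js ?ks orbT.
have [dE cE] := hE i (mem_head _ _).
set B := [set f | all _ s] in IH *.
have -> : [set f | (f \notin E i) && all (fun j => f \notin E j) s] = ~: E i :&: B.
  by apply/setP=> f; rewrite !inE.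
have ind : #|~: E i :&: B| * #|space| = #|~: E i| * #|B|.
  apply: (card_independent (D := D i)).
    by move=> f g fg; rewrite !inE (dE f g).
  move=> f g fg; rewrite !inE; apply: eq_in_all => j js.
  have [dj _] := hE j (mem_behead (s := i :: s) js).
  rewrite (dj f g) // => x xj; apply: fg; rewrite inE; apply: contra iNs => xi.
  by rewrite (hD i j (mem_head _ _) (mem_behead (s := i :: s) js) x xi xj).
have [sp0|sp0] := posnP #|space|.
  rewrite [#|_ :&: _|](_ : _ = 0) //; apply/eqP; rewrite -leqn0 -sp0; exact: max_card.
have cC : #|~: E i| * q <= #|space| * q.-1.
  have eC : #|~: E i| = #|space| - #|E i| by rewrite -(cardsC (E i)) addKn.
  by rewrite eC mulnBl -subn1 mulnBr muln1; apply: leq_sub2l; rewrite mulnC.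
rewrite -(leq_pmul2l sp0) mulnA [#|space| * #|_ :&: _|]mulnC ind !expnS.
have -> : #|~: E i| * #|B| * (q * q ^ size s) = (#|~: E i| * q) * (#|B| * q ^ size s) by lia.
have -> : #|space| * (#|space| * (q.-1 * q.-1 ^ size s)) =
  (#|space| * q.-1) * (#|space| * q.-1 ^ size s) by lia.
exact: leq_mul.
Qed.
End ProductSpace.

Section Packing.
Variables (H : sgraph) (d : nat).
Hypothesis degH : max_degree H <= d.

Definition nbhd (h : H) : {set H} := h |: [set u | edge h u].

Lemma nbhd_id h : h \in nbhd h.
Proof. exact: setU11. Qed.

Lemma nbhd_sym u v : (u \in nbhd v) = (v \in nbhd u).
Proof. by rewrite !inE eq_sym edge_sym. Qed.

Lemma card_nbhd h : #|nbhd h| <= d.+1.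
Proof.
rewrite cardsU1 inE edge_irr add1n ltnS; apply: leq_trans degH.
exact: (leq_bigmax (F := fun v : H => #|[set u | edge v u]|)).
Qed.

(** Equivalently, distinct members are at distance at least three. *)
Definition packing (Z : {set H}) : Prop :=
  {in Z &, forall x y u, u \in nbhd x -> u \in nbhd y -> x = y}.

(** Greedy choice: taking [z] discards only its ball of radius two, which has at most [d.+1 ^ 2]
    vertices. *)
Lemma large_packing (Z : {set H}) :
  exists2 Z' : {set H}, Z' \subset Z & packing Z' /\ #|Z| <= d.+1 ^ 2 * #|Z'|.
Proof.
have [n] := ubnP #|Z|; elim: n Z => // n IH Z Zn.
have [->|/set0Pn[z zZ]] := eqVneq Z set0.
  by exists set0; rewrite ?sub0set // cards0; split=> // x y; rewrite inE.
pose N2 := \bigcup_(u in nbhd z) nbhd u.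
have cN : #|N2| <= d.+1 ^ 2.
  apply: leq_trans (_ : \sum_(u in nbhd z) #|nbhd u| <= _).
    apply: (big_ind2 (fun (A : {set H}) k => #|A| <= k)) => //.
      by rewrite cards0.
    move=> A a B b Aa Bb; apply: leq_trans (leq_card_setU _ _) (leq_add Aa Bb).
  apply: leq_trans (_ : \sum_(u in nbhd z) d.+1 <= _).
    by apply: leq_sum => u _; apply: card_nbhd.
  by rewrite sum_nat_const -mulnn leq_mul2r card_nbhd orbT.
have zN : z \in N2 by apply/bigcupP; exists z; rewrite nbhd_id.
have [|Z' Z'Z [pZ cZ]] := IH (Z :\: N2).
  apply: (@leq_trans #|Z|) => //; apply: proper_card; rewrite properE subsetDl.
  by apply/subsetPn; exists z; rewrite // inE zN.
have nz y : y \in Z' -> forall u, u \in nbhd z -> u \in nbhd y -> False.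
  move=> /(subsetP Z'Z); rewrite inE => /andP[/negP yN _] u uz uy; apply: yN.
  by apply/bigcupP; exists u; rewrite // nbhd_sym.
exists (z |: Z').
  by rewrite subUset sub1set zZ (subset_trans Z'Z) // subsetDl.
split.
  move=> x y /setU1P[->|xZ] /setU1P[->|yZ] u // uz uy.
  - by case: (nz y yZ u).
  - by case: (nz x xZ u).
  - exact: pZ uz uy.
rewrite cardsU1 (_ : z \notin Z').
  have := cardsID N2 Z; have := subset_leq_card (subsetIr Z N2); lia.
by apply/negP => /(subsetP Z'Z); rewrite inE zN.
Qed.
End Packing.

(** * Random independent sets *)

Section Separators.
Variables (H G : sgraph) (B : H -> {set G}).
Hypothesis mB : minor_model B.

Definition anticomplete (U W : {set G}) : Prop :=
  forall u v, u \in U -> v \in W -> (u != v) && ~~ edge u v.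

Lemma anticomplete_sym U W : anticomplete U W -> anticomplete W U.
Proof. by move=> ac u v uU vW; rewrite eq_sym edge_sym; apply: ac. Qed.

Definition inside (U : {set G}) : {set H} := [set h | B h \subset U].

(** A path inside the connected set [B h] cannot step from [U] to [W]. *)
Lemma branch_set_side U W h : anticomplete U W -> B h \subset U :|: W ->
  (h \in inside U) || (h \in inside W).
Proof.
move=> ac hUW; have [_ con _ _] := mB; rewrite !inE.
have [//|/subsetPn[x xB xU]] := boolP (B h \subset U).
apply/subsetP=> y yB; have /setUP[yU|//] := subsetP hUW y yB.
exfalso; have /connectP[p] := con h y x yB xB.
elim: p y {yB} yU => [|z p IH] y yU /=; first by move=> _ xy; rewrite xy yU in xU.
case/andP=> /and3P[yz _ zB]; apply: IH.
have /setUP[//|zW] := subsetP hUW z zB.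
by have := ac y z yU zW; rewrite yz andbF.
Qed.

Lemma inside_anticomplete U W h k : anticomplete U W ->
  h \in inside U -> k \in inside W -> (h != k) && ~~ edge h k.
Proof.
move=> ac; rewrite !inE => /subsetP hU /subsetP kW; have [B0 _ _ Be] := mB.
have hk : h != k.
  apply/negP=> /eqP e; have /set0Pn[x xB] := B0 h.
  have xk : x \in B k by rewrite -e.
  by have := ac x x (hU x xB) (kW x xk); rewrite eqxx.
rewrite hk Be //; apply/negP=> /touchP[u [v [uh vk uv]]].
by have := ac u v (hU u uh) (kW v vk); rewrite uv andbF.
Qed.

Definition separator (U W : {set G}) : {set H} := [set h | ~~ (B h \subset U :|: W)].

Lemma separator_cases U W h : anticomplete U W ->
  [|| h \in inside U, h \in inside W | h \in separator U W].
Proof.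
move=> ac; rewrite orbA [h \in separator _ _]inE.
by have [/(branch_set_side ac) ->|_] := boolP (B h \subset U :|: W); rewrite ?orbT.
Qed.

(** For a given random set, [y x] will be a chosen vertex of [H] equal or adjacent to [x], and [r x]
    a vertex of the random set in its branch set. *)
Variables (X' : {set H}) (y : H -> H) (r : H -> G).
Hypothesis pX' : packing X'.
Hypothesis yX' : {in X', forall x, y x \in nbhd x}.
Hypothesis rX' : {in X', forall x, r x \in B (y x)}.

Lemma nbhd_choice_inj : {in X' &, injective y}.
Proof.
move=> a b aX bX e; apply: pX' (yX' aX) _ => //; rewrite e; exact: yX'.
Qed.

Lemma representative_inj : {in X' &, injective r}.
Proof.
move=> a b aX bX e; apply: nbhd_choice_inj => //; have [_ _ Bd _] := mB.
apply: (Bd _ _ (r a)); [exact: rX' | rewrite e; exact: rX'].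
Qed.

(* A point of the packing whose representative lies in [U] is itself on the
   [U]-side or in the separator, or else its neighbour is in the separator. *)
Lemma card_representatives U W (X : {set H}) : anticomplete U W -> X' \subset X ->
  #|r @: X' :&: U| <= #|(inside U :|: separator U W) :&: X| + #|separator U W|.
Proof.
move=> ac X'X; pose XU := [set x in X' | r x \in U].
have /subset_leq_card/leq_trans : r @: X' :&: U \subset r @: XU.
  apply/subsetP=> z /setIP[/imsetP[x xX ->] rU]; apply: imset_f.
  by rewrite inE xX.
apply; apply: leq_trans (leq_imset_card _ _) _.
pose XS := [set x in X' | y x \in separator U W].
have XScard : #|XS| <= #|separator U W|.
  rewrite -(card_in_imset (f := y) (D := mem XS)).
    by apply: subset_leq_card; apply/subsetP=> z /imsetP[x]; rewrite inE => /andP[_ ?] ->.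
  by move=> a b /setIdP[aX _] /setIdP[bX _]; apply: nbhd_choice_inj.
apply: leq_trans (_ : #|(inside U :|: separator U W) :&: X :|: XS| <= _); last first.
  by apply: leq_trans (leq_card_setU _ _) _; rewrite leq_add2l.
apply: subset_leq_card; apply/subsetP=> x /setIdP[xX rU].
rewrite in_setU in_setI (subsetP X'X) // andbT [x \in XS]inE xX /=.
have /or3P[yU|yW|->] := separator_cases (y x) ac; last by rewrite orbT.
  have /or3P[xU|xW|xS] := separator_cases x ac; try by rewrite in_setU ?xU ?xS ?orbT.
  have /andP[/negbTE ne] := inside_anticomplete ac yU xW.
  by have := yX' xX; rewrite !inE ne /= edge_sym => ->.
move: yW; rewrite inE => /subsetP/(_ _ (rX' xX)) rW.
by have := ac _ _ rU rW; rewrite eqxx.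
Qed.

(** Adding the separator [S] to both insides gives a separation of order [#|S|]. Each side has at
    least [#|X'| / 3 - #|S|] points of [X], so well-linkedness yields [#|X'| / 3 <= 2 * #|S|]. *)
Lemma card_separator U W (X : {set H}) :
  well_linked X -> X' \subset X -> anticomplete U W ->
  #|r @: X'| <= 3 * #|r @: X' :&: U| -> #|r @: X'| <= 3 * #|r @: X' :&: W| ->
  #|X'| <= 6 * #|separator U W|.
Proof.
move=> wl X'X ac; rewrite (card_in_imset representative_inj) => hU hW.
have cU := card_representatives ac X'X.
have cW := card_representatives (anticomplete_sym ac) X'X.
have sepC : separator W U = separator U W by apply/setP=> h; rewrite !inE setUC.
rewrite sepC in cW.
have sepI : (inside U :|: separator U W) :&: (inside W :|: separator U W) = separator U W.
  rewrite -setUIl; apply/setUidPr/subsetP=> h /setIP[hU' hW'].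
  by have := inside_anticomplete ac hU' hW'; rewrite eqxx.
have : separation (inside U :|: separator U W) (inside W :|: separator U W).
  apply/andP; split.
    apply/eqP/setP=> h; rewrite [h \in setT]inE; have := separator_cases h ac.
    by rewrite !in_setU; case/or3P=> ->; rewrite ?orbT.
  apply/forallP=> a; apply/forallP=> b; apply/implyP.
  rewrite !in_setU !negb_or => /andP[/andP[aW aS] /andP[bU bS]].
  have := separator_cases a ac; rewrite (negbTE aW) (negbTE aS) !orbF => aU.
  have := separator_cases b ac; rewrite (negbTE bU) (negbTE bS) orbF /= => bW.
  by have /andP[] := inside_anticomplete ac aU bW.
move/forallP/(_ (inside U :|: separator U W)): wl => /forallP/(_ (inside W :|: separator U W)).
move=> /implyP h /h; rewrite sepI => /orP[]; lia.
Qed.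
End Separators.

(** * The random independent set and its chance of avoiding a separator *)

Section RandomSet.
Variables (H G : sgraph) (d : nat) (B : H -> {set G}).
Let n := d.*2.+1.
Variable I : H -> 'I_n -> {set G}.
Hypotheses (degH : max_degree H <= d) (mB : minor_model B).
Hypothesis coverI : forall h, independent_cover (I h) (B h).
Variable X' : {set H}.
Hypothesis pX' : packing X'.
(** Each vertex of [H] receives a coin flip and the index of a class of its cover. *)
Local Notation space := {ffun H -> bool * 'I_n}.
Implicit Type f : space.

Definition active f : {set H} :=
  [set h | (f h).1 && [forall u, edge h u ==> ~~ (f u).1]].

(* Every closed neighbourhood of a point of the packing is hit. *)
Definition filled f : {set H} :=
  active f :|: [set x in X' | [disjoint nbhd x & active f]].

Definition selected f : {set G} := \bigcup_(h in filled f) I h (f h).2.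

Lemma active_independent f : independent (active f).
Proof.
move=> x z; rewrite !inE => /andP[_ /forallP ex] /andP[fz _].
by have := ex z; rewrite fz implybF.
Qed.

(** An added packing vertex has no active neighbour, and two packing vertices are never adjacent. *)
Lemma filled_independent f : independent (filled f).
Proof.
have H1 x z : x \in active f -> [disjoint nbhd z & active f] -> ~~ edge x z.
  move=> xa /pred0P/(_ x) /=; rewrite xa andbT => /negbT.
  by rewrite !inE negb_or edge_sym => /andP[].
move=> x z /setUP[xa|/setIdP[xX xd]] /setUP[za|/setIdP[zX zd]].
- exact: active_independent xa za.
- exact: H1.
- by rewrite edge_sym; apply: H1.
- apply/negP=> xz; have xz' : x = z.
    by apply: (pX' xX zX (u := x)); rewrite ?nbhd_id // !inE edge_sym xz orbT.
  by rewrite xz' edge_irr in xz.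
Qed.

Lemma selected_independent f : independent (selected f).
Proof.
move=> u v /bigcupP[h hf uh] /bigcupP[k kf vk].
have [IB _ iI _] := coverI h; have [IB' _ _ _] := coverI k.
have [e|hk] := eqVneq h k; first by rewrite -e in vk; apply: iI uh vk.
have [_ _ _ Be] := mB; have := filled_independent hf kf; rewrite Be //.
apply: contra => uv; apply/touchP; exists u, v; split=> //.
  exact: subsetP (IB _) _ uh.
exact: subsetP (IB' _) _ vk.
Qed.

Lemma filled_hits f x : x \in X' -> exists2 z, z \in nbhd x & z \in filled f.
Proof.
move=> xX; have [dx|/pred0Pn[z /andP[zx za]]] := boolP [disjoint nbhd x & active f].
  by exists x; [exact: nbhd_id|rewrite !inE xX dx orbT].
by exists z => //; apply/setUP; left.
Qed.

Definition event h c : {set space} := [set f | (h \in active f) && ((f h).2 == c)].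

Lemma event_depends h c : depends_on (nbhd h) (event h c).
Proof.
move=> f g fg; rewrite !inE (fg h) ?nbhd_id //; congr (_ && _ && _).
apply: eq_forallb => u; have [hu|//] := boolP (edge h u).
by rewrite fg // !inE hu orbT.
Qed.

(** Forcing the event at [h] erases only the coins on [nbhd h] and the class at [h]. [F] records
    these, and they take at most [2 ^ d.+1 * n] values. *)
Lemma card_event h c : #|space| <= 2 ^ d.+1 * n * #|event h c|.
Proof.
pose force f : space := [ffun u => if u == h then (true, c)
  else if u \in nbhd h then (false, (f u).2) else f u].
pose F f := (force f, ([set u in nbhd h | (f u).1], (f h).2)).
have Finj : injective F.
  move=> f g [ef es eh]; apply/ffunP=> u.
  have := congr1 (fun k : space => k u) ef; rewrite !ffunE.
  move/setP/(_ u): es; rewrite !in_set.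
  have [->|uh] := eqVneq u h; last first.
    case: ifP => [_ e [e2]|_ _ //].
    by move: e e2; case: (f u) (g u) => [a b] [a' b'] /= -> ->.
  by rewrite set11 /= => e _; move: e eh; case: (f h) (g h) => [a b] [a' b'] /= -> ->.
have Fsub : F @: setT \subset setX (event h c) (setX (powerset (nbhd h)) setT).
  apply/subsetP=> _ /imsetP[f _ ->]; rewrite !in_setX in_setT andbT.
  apply/andP; split; last by rewrite inE; apply/subsetP=> u /setIdP[].
  rewrite !inE !ffunE eqxx /= eqxx andbT; apply/forallP=> u; apply/implyP=> hu.
  rewrite ffunE; case: eqP => [e|_]; first by rewrite e edge_irr in hu.
  by rewrite !inE hu orbT.
have := subset_leq_card Fsub; rewrite card_imset // cardsT !cardsX card_powerset cardsT card_ord.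
move=> h1; apply: leq_trans h1 _; rewrite mulnC leq_mul2r leq_mul2r.
by rewrite leq_exp2l // card_nbhd // !orbT.
Qed.

(* Conditions on the neighbourhoods of a packing are independent, so the
   selected set rarely avoids a large separator. *)
Lemma card_selected_sub (U : {set G}) k :
  d.+1 ^ 2 * k < #|[set h | ~~ (B h \subset U)]| + d.+1 ^ 2 ->
  #|[set f | selected f \subset U]| * (2 ^ d.+1 * n) ^ k <=
  #|space| * (2 ^ d.+1 * n).-1 ^ k.
Proof.
set S := [set h | _] => hk.
have [S' S'S [pS cS]] := large_packing degH S.
have kS : k <= #|S'| by nia.
(* Some class of each branch set in [S] leaves [U]; drawing it at an active vertex takes the
   selected set out of [U]. *)
have /fin_all_exists[c cP] : forall h, exists c, h \in S -> ~~ (I h c \subset U).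
  move=> h; have [|_] := boolP (h \in S); last by exists ord0.
  rewrite inE => /subsetPn[v vB vU]; have [_ _ _ /(_ v vB)[c vc]] := coverI h.
  by exists c => _; apply/subsetPn; exists v.
pose s := take k (enum S').
have ss : size s = k by rewrite size_takel // -cardE.
have sS h : h \in s -> h \in S' by move/mem_take; rewrite mem_enum.
rewrite -ss; apply: leq_trans (@card_avoid _ _ _ (@nbhd H) (fun h => event h (c h)) _ s _ _ _ _).
- rewrite leq_mul2r; apply/orP; right; apply: subset_leq_card.
  apply/subsetP=> f; rewrite !inE => fU; apply/allP=> h hs.
  apply/negP; rewrite inE => /andP[ha /eqP e].
  have /negP := cP h (subsetP S'S _ (sS h hs)); apply; rewrite -e.
  apply: subset_trans fU; apply: (bigcup_sup h) => //; by rewrite in_setU ha.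
- by rewrite muln_gt0 expn_gt0.
- by apply: take_uniq; apply: enum_uniq.
- by move=> h _; split; [exact: event_depends|exact: card_event].
- by move=> h h' /sS hS /sS hS'; apply: pS.
Qed.
End RandomSet.

(** The first two binomial terms of [(q.-1 + 1) ^ q] are each at least [q.-1 ^ q]. *)
Lemma double_pred_expn q : 0 < q -> 2 * q.-1 ^ q <= q ^ q.
Proof.
case: q => // q _; rewrite -[X in _ <= X ^ _]addn1 expnDn (big_ord_recl q.+1) /=.
rewrite big_ord_recl /= bin0 bin1 !exp1n subn0 !muln1 !mul1n.
rewrite mul2n -addnn leq_add2l; apply: leq_trans (leq_addr _ _).
by rewrite /bump /= subn1 expnS leq_mul2r leqnSn orbT.
Qed.

Lemma ceil_div (D T : nat) : 0 < D -> exists k, T <= D * k /\ D * k < T + D.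
Proof.
move=> D0; exists ((T + D.-1) %/ D); have := divn_eq (T + D.-1) D.
by have := ltn_pmod (T + D.-1) D0; lia.
Qed.

Lemma circuit_size (G H : sgraph) (w d : nat) (C : tropical_circuit G) :
  induced_minor H G -> is_treewidth H w -> max_degree H <= d -> MWIS_circuit C ->
  d.+1 ^ 2 < w./2 ->
  exists k, w./2 <= 6 * d.+1 ^ 4 * k /\ 2 ^ k <= #|gate C| ^ (2 ^ d.+1 * d.*2.+1).
Proof.
move=> minH twH degH mwC w2.
have [B [I [mB coverI]]] := induced_minor_cover minH degH.
have [X Xw wlX] := treewidth_well_linked twH.
have [X' X'X [pX' cX]] := large_packing degH X.
have [U [W [acUW bal]]] := MWIS_circuit_balanced mwC.
rewrite Xw in cX.
(* A balanced gate requires two marks; here [d.+1 ^ 2 < w./2] provides them. *)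
have X'2 : 2 <= #|X'| by nia.
(* [k] is the ceiling of [#|X'| / (6 * d.+1 ^ 2)]: [card_separator] loses the factor 6, and a
   packing inside the separator the factor [d.+1 ^ 2]. *)
have [k [k1 k2]] : exists k, #|X'| <= 6 * d.+1 ^ 2 * k /\ 6 * d.+1 ^ 2 * k < #|X'| + 6 * d.+1 ^ 2.
  exact: ceil_div.
exists k; split.
  rewrite (leq_trans cX) // -[4]/(2 + 2) expnD; nia.
set q := 2 ^ d.+1 * d.*2.+1; pose space := {ffun H -> bool * 'I_(d.*2.+1)}.
pose bad g := if #|X'| <= 6 * #|separator B (U g) (W g)|
  then [set f : space | selected I X' f \subset U g :|: W g] else set0.
have q0 : 0 < q by rewrite muln_gt0 expn_gt0.
have badk g : #|bad g| * q ^ k <= #|space| * q.-1 ^ k.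
  rewrite /bad; case: ifP => [hS|_]; last by rewrite cards0.
  by apply: (card_selected_sub degH coverI); rewrite -/(separator B (U g) (W g)); nia.
(* Marking the representatives in the selected set of [f] yields a balanced gate, whose separator is
   large; so the bad events exhaust the space. *)
have cover (f : space) : exists g, f \in bad g.
  have /fin_all_exists[yr yrP] : forall x, exists yr : H * G, x \in X' ->
      [/\ yr.1 \in nbhd x, yr.2 \in B yr.1 & yr.2 \in selected I X' f].
    move=> x; have [xX|_] := boolP (x \in X'); last first.
      by have /set0Pn[v _] : B x != set0 by [case: mB]; exists (x, v).
    have [y yx yf] := filled_hits f xX.
    have [IB /(_ (f y).2)/set0Pn[v vI] _ _] := coverI y.
    exists (y, v) => _; split=> //=; first exact: subsetP (IB _) _ vI.
    by apply/bigcupP; exists y.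
  pose y x := (yr x).1; pose r x := (yr x).2.
  have yX : {in X', forall x, y x \in nbhd x} by move=> x /yrP[].
  have rX : {in X', forall x, r x \in B (y x)} by move=> x /yrP[].
  have rinj := representative_inj mB pX' yX rX.
  have [||g [sg gU gW]] := bal (selected I X' f) (r @: X')
    (selected_independent mB coverI pX' (f := f)).
  - by apply/subsetP=> _ /imsetP[x xX ->]; case: (yrP x xX).
  - by rewrite card_in_imset.
  exists g; rewrite /bad (card_separator mB pX' yX rX wlX X'X (acUW g) gU gW) inE.
  exact: sg.
have sp0 : 0 < #|space| by apply/card_gt0P; exists [ffun=> (true, ord0)].
have key : q ^ k <= #|gate C| * q.-1 ^ k.
  rewrite -(leq_pmul2l sp0) mulnCA.
  have : #|space| <= \sum_g #|bad g|.
    apply: leq_trans (_ : #|\bigcup_g bad g| <= _).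
      rewrite -cardsT; apply: subset_leq_card; apply/subsetP=> f _.
      by have [g fg] := cover f; apply/bigcupP; exists g.
    apply: (big_ind2 (fun (A : {set space}) j => #|A| <= j)) => //.
      by rewrite cards0.
    move=> a j b l Aa Bb; exact: leq_trans (leq_card_setU _ _) (leq_add Aa Bb).
  rewrite -(leq_pmul2r (m := q ^ k)) ?expn_gt0 ?q0 // => /leq_trans; apply.
  rewrite big_distrl /= -sum_nat_const; apply: leq_sum => g _; exact: badk.
have q1 : 0 < q.-1.
  by have p2 : 0 < 2 ^ d by [rewrite expn_gt0]; rewrite /q expnS; nia.
(* Taking [q]-th powers of [key] and using [2 * q.-1 ^ q <= q ^ q] leaves
   [2 ^ k <= #|gate C| ^ q]. *)
have key2 : (2 * q.-1 ^ q) ^ k <= (#|gate C| * q.-1 ^ k) ^ q.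
  apply: leq_trans (_ : (q ^ k) ^ q <= _); last by rewrite leq_exp2r.
  have k0 : 0 < k by rewrite lt0n; apply: contraTneq k1 => ->; rewrite muln0; lia.
  by rewrite -expnM [k * q]mulnC expnM leq_exp2r //; apply: double_pred_expn.
move: key2; rewrite !expnMn -!expnM [q * k]mulnC leq_pmul2r //.
by rewrite expn_gt0 q1.
Qed.

(** * The lower bound *)

Import Order.TTheory GRing.Theory Num.Theory.

Lemma induced_minor_vertex (G H : sgraph) :
  induced_minor H G -> 0 < max_degree H -> exists v : G, true.
Proof.
move=> /induced_minor_model[B [B0 _ _ _]].
have [h _ _|H0] := pickP (fun h : H => true); last by rewrite /max_degree big_pred0.
by have /set0Pn[v _] := B0 h; exists v.
Qed.

(** For [d >= 6] a step multiplies the left side by at most [(7 / 6) ^ 4 < 2]; small cases are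
    computed. *)
Lemma expn4_le d : d ^ 4 <= 32 * 2 ^ d.
Proof.
have [|d6] := leqP d 6; first by case: d => [|[|[|[|[|[|[|]]]]]]].
elim: d d6 => // d IH; rewrite ltnS leq_eqVlt => /orP[/eqP <- //|d6].
have {}IH := IH d6; rewrite [2 ^ _]expnS.
have : (6 * d.+1) ^ 4 <= (7 * d) ^ 4 by rewrite leq_exp2r //; lia.
rewrite !expnMn (_ : 6 ^ 4 = 1296) // (_ : 7 ^ 4 = 2401) //.
by move: (d.+1 ^ 4) (d ^ 4) (2 ^ d) IH => a b c; lia.
Qed.

(** The factor [d ^ 4] lost in [k] is absorbed into a second [2 ^ d], which produces [4 ^ d] and the
    32. The rest is [1728 = 3 * 6 * 16 * 6]. *)
Lemma exponent_large w d k : 0 < d -> d.+1 ^ 2 < w./2 -> w./2 <= 6 * d.+1 ^ 4 * k ->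
  w * (2 ^ d.+1 * d.*2.+1) <= (32 * 1728) * (d * 4 ^ d) * k.
Proof.
move=> d0 w2 wk.
have w3 : w <= 3 * w./2 by lia.
have d4 : d.+1 ^ 4 <= 16 * d ^ 4.
  by rewrite -[16]/(2 ^ 4) -expnMn leq_exp2r //; lia.
have wd : w <= 288 * d ^ 4 * k by nia.
have q6 : 2 ^ d.+1 * d.*2.+1 <= 6 * d * 2 ^ d by rewrite expnS; nia.
have e4 : 4 ^ d = 2 ^ d * 2 ^ d by rewrite -[4]/(2 * 2) expnMn.
have := leq_mul wd q6 => /leq_trans; apply; rewrite e4.
have -> : 288 * d ^ 4 * k * (6 * d * 2 ^ d) = d ^ 4 * (1728 * k * d * 2 ^ d).
  by move: (d ^ 4) (2 ^ d) => a b; lia.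
have -> : (32 * 1728) * (d * (2 ^ d * 2 ^ d)) * k = 32 * 2 ^ d * (1728 * k * d * 2 ^ d).
  by move: (2 ^ d) => b; lia.
by rewrite leq_mul2r expn4_le orbT.
Qed.

(** For small treewidth the exponent of the final bound is at most 1, and two gates suffice. *)
Lemma exponent_small w d : 0 < d -> w./2 <= d.+1 ^ 2 -> w <= (32 * 1728) * (d * 4 ^ d).
Proof.
move=> d0 w2; have d4 : d < 4 ^ d by apply: ltn_expl.
have w9 : w <= 9 * (d * d) by move: w2; rewrite -mulnn; nia.
by nia.
Qed.

Local Open Scope ring_scope.

Theorem theorem2 (R : realType) :
  exists c : R, 0 < c /\
    forall (G H : sgraph) (w d : nat),
      induced_minor H G -> is_treewidth H w -> max_degree H = d -> (1 <= d)%N ->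
      forall C : tropical_circuit G, MWIS_circuit C ->
        2 `^ (c * w%:R / (d%:R * 4 ^+ d)) <= #|gate C|%:R.
Proof.
exists ((32 * 1728)%N%:R^-1); split=> [|G H w d minH twH degH d1 C mwC]; first by rewrite invr_gt0 ltr0n.
set K := (32 * 1728)%N; set e := (X in 2 `^ X).
have eE : e = w%:R / (K * (d * 4 ^ d))%N%:R.
  by rewrite /e (natrM _ K) (natrM _ d) natrX [K%:R^-1 * _]mulrC -mulrA -invfM.
have N0 : 0 < (K * (d * 4 ^ d))%N%:R :> R by rewrite ltr0n !muln_gt0 d1 expn_gt0.
have [w2|w2] := leqP w./2 (d.+1 ^ 2)%N.
  have [v _] : exists v : G, true by apply: induced_minor_vertex minH _; rewrite degH.
  apply: (@le_trans _ _ 2%:R); last by rewrite ler_nat; apply: card_gate_gt1.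
  rewrite -[leRHS]powRr1 ?ler0n // ler_powR ?ler1n // eE ler_pdivrMr // mul1r ler_nat.
  exact: exponent_small.
have [|k [wk Nk]] := circuit_size minH twH _ mwC w2; first by rewrite degH.
set q := (2 ^ d.+1 * d.*2.+1)%N in Nk.
have q0 : (0 < q)%N by rewrite muln_gt0 expn_gt0.
(* Both sides are raised to the power [q] to match [2 ^ k <= #|gate C| ^ q]. *)
rewrite -(@ler_pXn2r _ q) ?nnegrE ?powR_ge0 ?ler0n //.
rewrite -powR_mulrn ?powR_ge0 // -powRrM -natrX.
apply: (@le_trans _ _ (2%:R `^ k%:R)); last first.
  by rewrite powR_mulrn ?ler0n // -natrX ler_nat.
rewrite ler_powR ?ler1n // eE mulrAC ler_pdivrMr // -!natrM ler_nat [(k * _)%N]mulnC.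
exact: exponent_large.
Qed.
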